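(* There is an absolute constant $C>0$ such that for every $n\ge1$, every function $g:\{0,1\}^n\to\{0,1\}$ and every bit-wise product distribution $\mu$ on $\{0,1\}^n$, $$\mathsf{QC}^\mu_{0.49}(g)\le C\left(\log \mathsf{qprt}_{1/8}(g)\cdot\log\log \mathsf{qprt}_{1/8}(g)\right)^2 + C.$$
   Context: A distribution $\mu$ on $\{0,1\}^n$ is bit-wise product if there are $p_i(0),p_i(1)\in[0,1]$ with $p_i(0)+p_i(1)=1$ such that $\mu(x)=\prod_{i=1}^n p_i(x_i)$. $\mathsf{QC}^\mu_\epsilon(g)$ is the minimum depth of a deterministic decision tree $T$ with $\Pr_{x\sim\mu}[T(x)\ne g(x)]\le\epsilon$. For $s\in\{0,1,\star\}^n$, the subcube with support $s$ is $\{x: s_i\neq\star\Rightarrow x_i=s_i\}$; for a subcube $A$ with support $s$, $|A|$ denotes the number of $i$ with $s_i\in\{0,1\}$. The $\epsilon$-query partition bound $\mathsf{qprt}_\epsilon(g)$ is the optimal value of the LP: minimize $\sum_{z\in\{0,1\}}\sum_A w_{z,A}2^{|A|}$ over subcubes $A$, subject to $\sum_{A\ni x} w_{g(x),A}\ge 1-\epsilon$ for all $x$; $\sum_{A\ni x}\sum_z w_{z,A}=1$ for all $x$; $w_{z,A}\ge0$. Logarithms base 2. *)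

(* Defs.v *)
From Stdlib Require Import Reals List Bool Arith.
Import ListNotations.
Open Scope R_scope.

Definition log2 (x : R) : R := ln x / ln 2.

Definition lsum {A : Type} (f : A -> R) (l : list A) : R :=
  fold_right (fun a acc => f a + acc) 0 l.

Fixpoint cube (n : nat) : list (list bool) :=
  match n with
  | O => [ [] ]
  | S m => map (cons false) (cube m) ++ map (cons true) (cube m)
  end.

(** enumeration of {0,1,*}^n : None = star, Some b = fixed bit b *)
Fixpoint supports (n : nat) : list (list (option bool)) :=
  match n with
  | O => [ [] ]
  | S m => map (cons None) (supports m) ++ map (cons (Some false)) (supports m)
           ++ map (cons (Some true)) (supports m)
  end.

Fixpoint in_sub (x : list bool) (s : list (option bool)) : bool :=
  match x, s with
  | [], [] => true
  | b :: x', o :: s' =>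
      (match o with None => true | Some c => Bool.eqb b c end) && in_sub x' s'
  | _, _ => false
  end.

Definition codim (s : list (option bool)) : nat :=
  length (filter (fun o => match o with Some _ => true | None => false end) s).

(** bit-wise product distribution: p i = p_i(1), 1 - p i = p_i(0) *)
Definition is_bitwise (n : nat) (p : nat -> R) : Prop :=
  forall i, (i < n)%nat -> 0 <= p i <= 1.

Definition mu (p : nat -> R) (x : list bool) : R :=
  fold_right Rmult 1
    (map (fun i => if nth i x false then p i else 1 - p i) (seq 0 (length x))).

Inductive dtree : Type :=
  | Leaf : bool -> dtree
  | Node : nat -> dtree -> dtree -> dtree.  (* query x_i; left if 0, right if 1 *)

Fixpoint depth (t : dtree) : nat :=
  match t with
  | Leaf _ => O
  | Node _ t0 t1 => S (Nat.max (depth t0) (depth t1))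
  end.

Fixpoint eval (t : dtree) (x : list bool) : bool :=
  match t with
  | Leaf b => b
  | Node i t0 t1 => if nth i x false then eval t1 x else eval t0 x
  end.

Definition err (n : nat) (p : nat -> R) (g : list bool -> bool) (t : dtree) : R :=
  lsum (fun x => if Bool.eqb (eval t x) (g x) then 0 else mu p x) (cube n).

Definition is_QC (n : nat) (p : nat -> R) (eps : R) (g : list bool -> bool) (q : nat)
  : Prop :=
  (exists t, err n p g t <= eps /\ depth t = q) /\
  (forall t, err n p g t <= eps -> (q <= depth t)%nat).

(** feasibility for the query partition bound LP; w z s = w_{z,A} for A with support s *)
Definition qprt_feasible (n : nat) (eps : R) (g : list bool -> bool)
  (w : bool -> list (option bool) -> R) : Prop :=
  (forall z s, 0 <= w z s) /\
  (forall x, In x (cube n) ->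
     lsum (fun s => if in_sub x s then w (g x) s else 0) (supports n) >= 1 - eps) /\
  (forall x, In x (cube n) ->
     lsum (fun s => if in_sub x s then w false s + w true s else 0) (supports n) = 1).

Definition qprt_obj (n : nat) (w : bool -> list (option bool) -> R) : R :=
  lsum (fun s => (w false s + w true s) * 2 ^ codim s) (supports n).

Definition is_qprt (n : nat) (eps : R) (g : list bool -> bool) (v : R) : Prop :=
  (exists w, qprt_feasible n eps g w /\ qprt_obj n w = v) /\
  (forall w, qprt_feasible n eps g w -> v <= qprt_obj n w).

(* Main.v *)
Require Import Defs.
From Stdlib Require Import Reals List Bool Arith ZArith Lra Lia Classical.
Import ListNotations.
Open Scope R_scope.

(** Since subcubes of codimension above [k = log v + 6] carry total weight at
    most [1/64], they can be dropped from an optimal fractional partition, and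
    every point is still covered with weight [> 0.85] by subcubes bearing the
    correct label and with weight at most [1/8] by those bearing the wrong one.

    Suppose [g] is nearly balanced under the product measure.  By averaging,
    some [0]-labelled subcube [A] of codimension at most [k] satisfies
    [Pr(g = 1 | A) <= 1/5].  A [1]-labelled subcube [B] that agrees with [A] on
    their common coordinates satisfies [mu(B) <= mu(B | A)], so such [B] have
    [mu]-mass at most [1/8 + 1/5], whereas the whole [1]-labelled mass exceeds
    [0.41].  Hence a mass [1/10] of [1]-labelled subcubes conflicts with [A],
    and querying the coordinates of [A] shortens each of those by at least one.
    The potential "expected number of still unqueried coordinates of the
    [1]-labelled subcubes containing [x]" starts below [k] and loses [1/10] in
    every such round, so after [O(k)] rounds of at most [k] queries the function
    is unbalanced on all but a hundredth of the leaves: [O(k^2)] queries are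
    enough. *)

(** * Finite sums *)

Lemma lsum_cons {A : Type} (f : A -> R) (a : A) (l : list A) :
  lsum f (a :: l) = f a + lsum f l.
Proof. reflexivity. Qed.

Lemma lsum_ext {A : Type} (f h : A -> R) (l : list A) :
  (forall a, In a l -> f a = h a) -> lsum f l = lsum h l.
Proof.
  induction l as [|a l IH]; intros H; [reflexivity|].
  rewrite !lsum_cons, (H a (or_introl eq_refl)), IH; [reflexivity|].
  intros; apply H; now right.
Qed.

Lemma lsum_le {A : Type} (f h : A -> R) (l : list A) :
  (forall a, In a l -> f a <= h a) -> lsum f l <= lsum h l.
Proof.
  induction l as [|a l IH]; simpl; intros H; [lra|].
  apply Rplus_le_compat; [apply H | apply IH; intros; apply H]; auto.
Qed.

Lemma lsum_zero {A : Type} (l : list A) : lsum (fun _ => 0) l = 0.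
Proof. induction l as [|a l IH]; simpl; rewrite ?lsum_cons, ?IH; simpl; lra. Qed.

Lemma lsum_nonneg {A : Type} (f : A -> R) (l : list A) :
  (forall a, In a l -> 0 <= f a) -> 0 <= lsum f l.
Proof. intros H; rewrite <- (lsum_zero l); apply lsum_le, H. Qed.

Lemma lsum_plus {A : Type} (f h : A -> R) (l : list A) :
  lsum (fun a => f a + h a) l = lsum f l + lsum h l.
Proof. induction l as [|a l IH]; simpl; rewrite ?lsum_cons, ?IH; simpl; lra. Qed.

Lemma lsum_scal {A : Type} (c : R) (f : A -> R) (l : list A) :
  lsum (fun a => c * f a) l = c * lsum f l.
Proof. induction l as [|a l IH]; simpl; rewrite ?lsum_cons, ?IH; simpl; lra. Qed.

Lemma lsum_app {A : Type} (f : A -> R) (l1 l2 : list A) :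
  lsum f (l1 ++ l2) = lsum f l1 + lsum f l2.
Proof. induction l1 as [|a l IH]; simpl; rewrite ?lsum_cons, ?IH; simpl; lra. Qed.

Lemma lsum_map {A B : Type} (f : B -> R) (h : A -> B) (l : list A) :
  lsum f (map h l) = lsum (fun a => f (h a)) l.
Proof. induction l as [|a l IH]; simpl; rewrite ?lsum_cons, ?IH; simpl; lra. Qed.

Lemma lsum_swap {A B : Type} (f : A -> B -> R) (l1 : list A) (l2 : list B) :
  lsum (fun a => lsum (f a) l2) l1 = lsum (fun b => lsum (fun a => f a b) l1) l2.
Proof.
  induction l1 as [|a l IH]; [symmetry; apply lsum_zero|].
  rewrite lsum_cons, IH, <- lsum_plus; reflexivity.
Qed.

Lemma lsum_filter {A : Type} (f : A -> bool) (l : list A) :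
  lsum (fun a => if f a then 1 else 0) l = INR (length (filter f l)).
Proof.
  induction l as [|a l IH]; [reflexivity|].
  rewrite lsum_cons, IH; simpl filter; destruct (f a); cbn [length]; [rewrite S_INR|]; lra.
Qed.

Lemma cube_length (n : nat) (x : list bool) : In x (cube n) -> length x = n.
Proof.
  revert x; induction n as [|n IH]; simpl; intros x H.
  - destruct H as [<-|[]]; reflexivity.
  - apply in_app_or in H; destruct H as [H|H]; apply in_map_iff in H;
      destruct H as [y [<- Hy]]; simpl; now rewrite IH.
Qed.

Lemma supports_length (n : nat) (s : list (option bool)) :
  In s (supports n) -> length s = n.
Proof.
  revert s; induction n as [|n IH]; simpl; intros s H.
  - destruct H as [<-|[]]; reflexivity.
  - rewrite !in_app_iff in H; destruct H as [H|[H|H]]; apply in_map_iff in H;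
      destruct H as [y [<- Hy]]; simpl; now rewrite IH.
Qed.

(** * Product measures *)

Definition bitp (q : R) (b : bool) : R := if b then q else 1 - q.

Lemma bitp_range (q : R) (b : bool) : 0 <= q <= 1 -> 0 <= bitp q b <= 1.
Proof. destruct b; simpl; lra. Qed.

Lemma is_bitwise_tail (n : nat) (p : nat -> R) :
  is_bitwise (S n) p -> is_bitwise n (fun i => p (S i)).
Proof. intros H i Hi; apply H; lia. Qed.

Lemma mu_cons (p : nat -> R) (b : bool) (x : list bool) :
  mu p (b :: x) = bitp (p O) b * mu (fun i => p (S i)) x.
Proof.
  unfold mu; simpl; rewrite <- seq_shift, map_map; reflexivity.
Qed.

Lemma mu_nonneg (n : nat) (p : nat -> R) (x : list bool) :
  is_bitwise n p -> length x = n -> 0 <= mu p x.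
Proof.
  revert n p; induction x as [|b x IH]; intros n p Hp Hx.
  - unfold mu; simpl; lra.
  - destruct n as [|n]; [discriminate|]; rewrite mu_cons; apply Rmult_le_pos.
    + apply bitp_range, Hp; lia.
    + apply (IH n); [apply is_bitwise_tail, Hp | now injection Hx].
Qed.

Definition expect (n : nat) (p : nat -> R) (f : list bool -> R) : R :=
  lsum (fun x => mu p x * f x) (cube n).

Lemma expect_ext (n : nat) (p : nat -> R) (f h : list bool -> R) :
  (forall x, In x (cube n) -> f x = h x) -> expect n p f = expect n p h.
Proof. intros H; apply lsum_ext; intros x Hx; now rewrite H. Qed.

Lemma expect_le (n : nat) (p : nat -> R) (f h : list bool -> R) :
  is_bitwise n p -> (forall x, In x (cube n) -> f x <= h x) ->
  expect n p f <= expect n p h.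
Proof.
  intros Hp H; apply lsum_le; intros x Hx; apply Rmult_le_compat_l; [|auto].
  apply (mu_nonneg n); [|apply cube_length]; assumption.
Qed.

Lemma expect_plus (n : nat) (p : nat -> R) (f h : list bool -> R) :
  expect n p (fun x => f x + h x) = expect n p f + expect n p h.
Proof. unfold expect; rewrite <- lsum_plus; apply lsum_ext; intros; ring. Qed.

Lemma expect_scal (n : nat) (p : nat -> R) (c : R) (f : list bool -> R) :
  expect n p (fun x => c * f x) = c * expect n p f.
Proof. unfold expect; rewrite <- lsum_scal; apply lsum_ext; intros; ring. Qed.

Lemma expect_one (n : nat) (p : nat -> R) : expect n p (fun _ => 1) = 1.
Proof.
  revert p; induction n as [|n IH]; intros p.
  - unfold expect, mu; simpl; lra.
  - unfold expect in *; simpl cube; rewrite lsum_app, !lsum_map.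
    rewrite (lsum_ext (fun x => mu p (false :: x) * 1)
               (fun x => (1 - p O) * (mu (fun i => p (S i)) x * 1)))
      by (intros; rewrite mu_cons; simpl; ring).
    rewrite (lsum_ext (fun x => mu p (true :: x) * 1)
               (fun x => p O * (mu (fun i => p (S i)) x * 1)))
      by (intros; rewrite mu_cons; simpl; ring).
    rewrite !lsum_scal, IH; ring.
Qed.

(** * Subcubes: mass, conditioning and conflict *)

Fixpoint submu (p : nat -> R) (s : list (option bool)) : R :=
  match s with
  | [] => 1
  | o :: s' =>
      match o with None => 1 | Some b => bitp (p O) b end
      * submu (fun i => p (S i)) s'
  end.

Lemma submu_nonneg (n : nat) (p : nat -> R) (s : list (option bool)) :
  is_bitwise n p -> length s = n -> 0 <= submu p s.
Proof.
  revert n p; induction s as [|o s IH]; intros n p Hp Hs; simpl; [lra|].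
  destruct n as [|n]; [discriminate|]; apply Rmult_le_pos.
  - destruct o; [apply bitp_range, Hp; lia | lra].
  - apply (IH n); [apply is_bitwise_tail, Hp | now injection Hs].
Qed.

(** The conditional measure on a subcube is again a product measure, with the
    fixed bits made deterministic; it stays defined when the subcube is null. *)
Definition cond (p : nat -> R) (s : list (option bool)) (i : nat) : R :=
  match nth i s None with
  | None => p i
  | Some b => if b then 1 else 0
  end.

Lemma cond_bitwise (n : nat) (p : nat -> R) (s : list (option bool)) :
  is_bitwise n p -> is_bitwise n (cond p s).
Proof.
  intros H i Hi; unfold cond; destruct (nth i s None) as [[]|]; [lra|lra|auto].
Qed.

(** Bayes' rule in multiplied form: without a division it also covers null subcubes. *)
Lemma mu_cond (p : nat -> R) (s : list (option bool)) (x : list bool) :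
  length x = length s ->
  submu p s * mu (cond p s) x = if in_sub x s then mu p x else 0.
Proof.
  revert p x; induction s as [|o s IH]; intros p [|b x] H; try discriminate.
  - unfold mu; simpl; ring.
  - injection H as H; rewrite !mu_cons.
    change (mu (fun i => cond p (o :: s) (S i)) x)
      with (mu (cond (fun i => p (S i)) s) x).
    specialize (IH (fun i => p (S i)) x H); simpl.
    (* If the tail misses the subcube, the induction hypothesis is a vanishing product, so one of
       its two factors is zero. *)
    destruct (in_sub x s);
      [rewrite <- IH
      |apply Rmult_integral in IH; destruct IH as [IH|IH]; rewrite IH];
      destruct o as [[]|], b; unfold cond; simpl; ring.
Qed.

Lemma expect_cond (n : nat) (p : nat -> R) (s : list (option bool))
  (f : list bool -> R) :
  length s = n ->
  submu p s * expect n (cond p s) f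
  = expect n p (fun x => if in_sub x s then f x else 0).
Proof.
  intros Hs; unfold expect; rewrite <- lsum_scal; apply lsum_ext; intros x Hx.
  rewrite <- Rmult_assoc, mu_cond by (rewrite Hs; apply cube_length, Hx).
  destruct (in_sub x s); ring.
Qed.

Definition cover (n : nat) (w : list (option bool) -> R) (x : list bool) : R :=
  lsum (fun s => if in_sub x s then w s else 0) (supports n).

(** Exchange of sums: drawing [x] and weighing the subcubes around it amounts to weighing each
    subcube by its mass and drawing [x] inside it. *)
Lemma expect_cover (n : nat) (p : nat -> R) (w : list (option bool) -> R)
  (f : list bool -> R) :
  expect n p (fun x => f x * cover n w x)
  = lsum (fun s => w s * submu p s * expect n (cond p s) f) (supports n).
Proof.
  unfold expect at 1, cover.
  rewrite (lsum_ext _ (fun x => lsum (fun s =>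
             mu p x * (w s * if in_sub x s then f x else 0)) (supports n))).
  2: { intros x _; rewrite <- !lsum_scal; apply lsum_ext; intros s _.
       destruct (in_sub x s); ring. }
  rewrite lsum_swap; apply lsum_ext; intros s Hs.
  rewrite Rmult_assoc, expect_cond by now apply supports_length.
  unfold expect; rewrite <- lsum_scal; apply lsum_ext; intros x _; ring.
Qed.

Lemma expect_cover_one (n : nat) (p : nat -> R) (w : list (option bool) -> R) :
  expect n p (cover n w) = lsum (fun s => w s * submu p s) (supports n).
Proof.
  rewrite (expect_ext n p _ (fun x => 1 * cover n w x)) by (intros; ring).
  rewrite expect_cover; apply lsum_ext; intros s _; rewrite expect_one; ring.
Qed.

(** For supports of equal length this is disjointness of the subcubes; the default [None] turns
    positions past the end into stars. *)
Definition conflict (s s' : list (option bool)) : Prop :=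
  exists i b, nth i s None = Some b /\ nth i s' None = Some (negb b).

(** Bit by bit: a bit of [s'] that [s] also fixes has the same value there, so its factor rises to
    1; every other factor is unchanged. *)
Lemma submu_cond (n : nat) (p : nat -> R) (s s' : list (option bool)) :
  is_bitwise n p -> length s = n -> length s' = n -> ~ conflict s s' ->
  submu p s' <= submu (cond p s) s'.
Proof.
  revert n p s; induction s' as [|o' s' IH]; intros n p [|o s] Hp Hs Hs' Hc;
    try (subst; discriminate); [simpl; lra|].
  destruct n as [|n]; [discriminate|]; injection Hs as Hs; injection Hs' as Hs'.
  change (submu (cond p (o :: s)) (o' :: s'))
    with (match o' with None => 1 | Some b => bitp (cond p (o :: s) O) b end
          * submu (cond (fun i => p (S i)) s) s').
  simpl; apply Rmult_le_compat.
  - destruct o'; [apply bitp_range, Hp; lia | lra].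
  - apply (submu_nonneg n); [apply is_bitwise_tail, Hp | assumption].
  - specialize (Hp O ltac:(lia)); unfold cond; simpl.
    destruct o' as [b'|]; [|lra]; destruct o as [b|]; [|lra].
    destruct (Bool.bool_dec b' b) as [->|Hb].
    + destruct b; simpl; lra.
    + exfalso; apply Hc; exists O, b; split; [reflexivity|].
      simpl; destruct b, b'; simpl; congruence.
  - apply (IH n); auto using is_bitwise_tail.
    intros [i [b Hib]]; apply Hc; exists (S i), b; exact Hib.
Qed.

Lemma submu_fixed_pos (p : nat -> R) (s : list (option bool)) (i : nat) (b : bool) :
  nth i s None = Some b -> submu p s <> 0 -> bitp (p i) b <> 0.
Proof.
  revert p i; induction s as [|o s IH]; intros p [|i] H Hs; try discriminate;
    simpl in *.
  - subst o; intros E; rewrite E in Hs; apply Hs; ring.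
  - apply (IH (fun i => p (S i))); [exact H|].
    intros E; rewrite E in Hs; apply Hs; ring.
Qed.

(** * Querying one coordinate *)

(** An answered bit becomes deterministic and the dimension stays, so [g] and the supports need no
    reindexing along the tree. *)
Definition upd (p : nat -> R) (i : nat) (b : bool) (j : nat) : R :=
  if Nat.eqb j i then (if b then 1 else 0) else p j.

Lemma upd_bitwise (n : nat) (p : nat -> R) (i : nat) (b : bool) :
  is_bitwise n p -> is_bitwise n (upd p i b).
Proof.
  intros H j Hj; unfold upd; destruct (Nat.eqb j i); [destruct b; lra | auto].
Qed.

Lemma mu_upd (p : nat -> R) (i : nat) (b : bool) (x : list bool) :
  (i < length x)%nat ->
  bitp (p i) b * mu (upd p i b) x
  = if Bool.eqb (nth i x false) b then mu p x else 0.
Proof.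
  revert p i; induction x as [|c x IH]; intros p i Hi; simpl in Hi; [lia|].
  rewrite !mu_cons; destruct i as [|i].
  - change (mu (fun j => upd p 0 b (S j)) x) with (mu (fun j => p (S j)) x).
    unfold upd; simpl; destruct b, c; simpl; ring.
  - change (mu (fun j => upd p (S i) b (S j)) x)
      with (mu (upd (fun j => p (S j)) i b) x).
    change (upd p (S i) b O) with (p O).
    specialize (IH (fun j => p (S j)) i ltac:(lia)); simpl in *.
    rewrite <- Rmult_assoc, (Rmult_comm _ (bitp (p O) c)), Rmult_assoc, IH.
    destruct (Bool.eqb (nth i x false) b); ring.
Qed.

Lemma submu_upd (p : nat -> R) (i : nat) (s : list (option bool)) :
  p i * submu (upd p i true) s + (1 - p i) * submu (upd p i false) s = submu p s.
Proof.
  revert p i; induction s as [|o s IH]; intros p i; simpl; [ring|].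
  destruct i as [|i].
  - change (submu (fun j => upd p 0 true (S j)) s) with (submu (fun j => p (S j)) s).
    change (submu (fun j => upd p 0 false (S j)) s) with (submu (fun j => p (S j)) s).
    unfold upd; simpl; destruct o as [[]|]; simpl; ring.
  - change (submu (fun j => upd p (S i) true (S j)) s)
      with (submu (upd (fun j => p (S j)) i true) s).
    change (submu (fun j => upd p (S i) false (S j)) s)
      with (submu (upd (fun j => p (S j)) i false) s).
    rewrite <- (IH (fun j => p (S j)) i).
    change (upd p (S i) true O) with (p O); change (upd p (S i) false O) with (p O).
    ring.
Qed.

Lemma err_node (n : nat) (p : nat -> R) (g : list bool -> bool) (i : nat)
  (t0 t1 : dtree) :
  (i < n)%nat ->
  err n p g (Node i t0 t1)
  = p i * err n (upd p i true) g t1 + (1 - p i) * err n (upd p i false) g t0.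
Proof.
  intros Hi; unfold err; rewrite <- !lsum_scal, <- lsum_plus.
  apply lsum_ext; intros x Hx; apply cube_length in Hx; subst n; simpl.
  pose proof (mu_upd p i true x Hi) as H1; pose proof (mu_upd p i false x Hi) as H0.
  simpl in H1, H0; destruct (nth i x false); simpl in H1, H0;
    destruct (Bool.eqb (eval t1 x) (g x)), (Bool.eqb (eval t0 x) (g x));
    lra.
Qed.

Definition indic (g : list bool -> bool) (z : bool) (x : list bool) : R :=
  if Bool.eqb (g x) z then 1 else 0.

Lemma err_leaf (n : nat) (p : nat -> R) (g : list bool -> bool) (z : bool) :
  err n p g (Leaf z) = expect n p (indic g (negb z)).
Proof.
  apply lsum_ext; intros x _; unfold indic; simpl.
  destruct z, (g x); simpl; ring.
Qed.

Lemma expect_indic (n : nat) (p : nat -> R) (g : list bool -> bool) :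
  expect n p (indic g false) + expect n p (indic g true) = 1.
Proof.
  rewrite <- expect_plus, <- (expect_one n p); apply expect_ext.
  intros x _; unfold indic; destruct (g x); simpl; ring.
Qed.

Lemma err_le_1 (n : nat) (p : nat -> R) (g : list bool -> bool) (t : dtree) :
  is_bitwise n p -> err n p g t <= 1.
Proof.
  intros Hp; rewrite <- (expect_one n p); apply lsum_le; intros x Hx.
  apply cube_length in Hx; pose proof (mu_nonneg n p x Hp Hx).
  destruct (Bool.eqb (eval t x) (g x)); lra.
Qed.

(** * The potential *)

(** The product vanishes exactly at 0 and 1, so this marks the bits that are still random. *)
Definition free (q : R) : R := if Req_EM_T (q * (1 - q)) 0 then 0 else 1.

Lemma free_range (q : R) : 0 <= free q <= 1.
Proof. unfold free; destruct (Req_EM_T (q * (1 - q)) 0); lra. Qed.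

Definition is_fixed (s : list (option bool)) (i : nat) : bool :=
  match nth i s None with Some _ => true | None => false end.

(** Querying a bit makes it deterministic, so only random bits count as not yet
    queried; [l] lists bits about to be queried. *)
Definition unqueried (n : nat) (l : list nat) (p : nat -> R)
  (s : list (option bool)) : R :=
  lsum (fun i => if in_dec Nat.eq_dec i l then 0
                 else if is_fixed s i then free (p i) else 0) (seq 0 n).

(** After exchanging sums, this is the expected weighted number of unqueried coordinates over the
    subcubes containing a random [x]. Adding a bit to [l] averages over its answer, by
    [potential_upd]. *)
Definition potential (n : nat) (w : list (option bool) -> R) (l : list nat)
  (p : nat -> R) : R :=
  lsum (fun s => w s * submu p s * unqueried n l p s) (supports n).

Lemma unqueried_nonneg (n : nat) (l : list nat) (p : nat -> R)
  (s : list (option bool)) : 0 <= unqueried n l p s.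
Proof.
  apply lsum_nonneg; intros i _; destruct (in_dec Nat.eq_dec i l); [lra|].
  destruct (is_fixed s i); [apply free_range | lra].
Qed.

Lemma fixed_codim (s : list (option bool)) :
  length (filter (is_fixed s) (seq 0 (length s))) = codim s.
Proof.
  unfold codim; induction s as [|o s IH]; [reflexivity|].
  simpl length at 2; cbn [seq]; rewrite <- seq_shift.
  assert (E : forall l, length (filter (is_fixed (o :: s)) (map S l))
                        = length (filter (is_fixed s) l)).
  { induction l as [|a l IHl]; [reflexivity|]; simpl.
    change (is_fixed (o :: s) (S a)) with (is_fixed s a).
    destruct (is_fixed s a); simpl; now rewrite IHl. }
  destruct o; simpl; rewrite E, IH; reflexivity.
Qed.

Lemma unqueried_le_codim (n : nat) (l : list nat) (p : nat -> R)
  (s : list (option bool)) :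
  length s = n -> unqueried n l p s <= INR (codim s).
Proof.
  intros Hs; rewrite <- fixed_codim, <- lsum_filter, Hs; apply lsum_le.
  intros i _; pose proof (free_range (p i)).
  destruct (in_dec Nat.eq_dec i l), (is_fixed s i); lra.
Qed.

Lemma unqueried_upd (n : nat) (i : nat) (l : list nat) (p : nat -> R) (b : bool)
  (s : list (option bool)) :
  unqueried n l (upd p i b) s = unqueried n (i :: l) p s.
Proof.
  apply lsum_ext; intros j _; unfold upd.
  destruct (Nat.eqb_spec j i) as [->|Hj].
  - destruct (in_dec Nat.eq_dec i (i :: l)) as [_|H]; [|exfalso; apply H; left; auto].
    destruct (in_dec Nat.eq_dec i l); [reflexivity|].
    destruct (is_fixed s i); [|reflexivity]; unfold free.
    destruct b; destruct (Req_EM_T _ 0) as [_|H]; try reflexivity; exfalso; lra.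
  - destruct (in_dec Nat.eq_dec j l) as [H|H],
      (in_dec Nat.eq_dec j (i :: l)) as [H'|H']; try reflexivity; exfalso.
    + apply H'; right; exact H.
    + destruct H' as [H'|H']; [congruence | contradiction].
Qed.

(** By [unqueried_upd] the count after the query does not depend on the answer, so only the masses
    have to be averaged. *)
Lemma potential_upd (n : nat) (w : list (option bool) -> R) (i : nat)
  (l : list nat) (p : nat -> R) :
  p i * potential n w l (upd p i true) + (1 - p i) * potential n w l (upd p i false)
  = potential n w (i :: l) p.
Proof.
  unfold potential; rewrite <- !lsum_scal, <- lsum_plus; apply lsum_ext; intros s _.
  rewrite !unqueried_upd, <- (submu_upd p i s); ring.
Qed.

Lemma potential_nonneg (n : nat) (w : list (option bool) -> R) (l : list nat)
  (p : nat -> R) :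
  (forall s, 0 <= w s) -> is_bitwise n p -> 0 <= potential n w l p.
Proof.
  intros Hw Hp; apply lsum_nonneg; intros s Hs; apply supports_length in Hs.
  apply Rmult_le_pos; [apply Rmult_le_pos|]; auto using unqueried_nonneg.
  now apply (submu_nonneg n).
Qed.

(** Error and potential both average over the answers, so an affine inequality between them passes
    from the ends of the queries back to the root. *)
Lemma query_list (n : nat) (g : list bool -> bool) (w : list (option bool) -> R)
  (a b : R) (d : nat) (l : list nat) :
  (forall i, In i l -> (i < n)%nat) ->
  (forall p, is_bitwise n p -> exists t,
     (depth t <= d)%nat /\ a * err n p g t <= potential n w [] p + b) ->
  forall p, is_bitwise n p -> exists t,
    (depth t <= length l + d)%nat /\ a * err n p g t <= potential n w l p + b.
Proof.
  intros Hl H; induction l as [|i l IH]; intros p Hp; [exact (H p Hp)|].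
  destruct (IH (fun j Hj => Hl j (or_intror Hj)) _ (upd_bitwise n p i false Hp))
    as [t0 [D0 E0]].
  destruct (IH (fun j Hj => Hl j (or_intror Hj)) _ (upd_bitwise n p i true Hp))
    as [t1 [D1 E1]].
  assert (Hi : (i < n)%nat) by (apply Hl; left; reflexivity).
  exists (Node i t0 t1); split; [simpl; lia|].
  rewrite err_node, <- potential_upd by exact Hi.
  pose proof (Hp i Hi) as Hpi.
  apply (Rmult_le_compat_l (p i)) in E1; [|lra].
  apply (Rmult_le_compat_l (1 - p i)) in E0; [|lra].
  lra.
Qed.

(** Two non-null subcubes fix the conflict coordinate to opposite bits, so its probability is
    neither 0 nor 1: it is random, counted on the right and no longer on the left. *)
Lemma unqueried_conflict (n : nat) (p : nat -> R) (s s' : list (option bool)) :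
  length s = n -> submu p s <> 0 -> submu p s' <> 0 -> conflict s s' ->
  unqueried n (filter (is_fixed s) (seq 0 n)) p s' + 1 <= unqueried n [] p s'.
Proof.
  intros Hs H H' [i [b [Hi Hi']]].
  assert (Hin : In i (seq 0 n)).
  { apply in_seq; split; [lia|]; destruct (le_lt_dec n i) as [Hle|Hlt]; [|lia].
    rewrite nth_overflow in Hi by lia; discriminate. }
  assert (Hfree : free (p i) = 1).
  { pose proof (submu_fixed_pos _ _ _ _ Hi H) as N1.
    pose proof (submu_fixed_pos _ _ _ _ Hi' H') as N2.
    unfold free; destruct (Req_EM_T (p i * (1 - p i)) 0) as [E|]; [|reflexivity].
    apply Rmult_integral in E; destruct b, E; simpl in *; contradiction. }
  set (l := filter (is_fixed s) (seq 0 n)).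
  assert (Hil : In i l).
  { apply filter_In; split; [exact Hin|]; unfold is_fixed; now rewrite Hi. }
  assert (Hone : 1 <= lsum (fun j => if Nat.eqb j i then 1 else 0) (seq 0 n)).
  { rewrite lsum_filter.
    assert (In i (filter (fun j => Nat.eqb j i) (seq 0 n))) as Hf
      by (apply filter_In; split; [exact Hin | apply Nat.eqb_refl]).
    apply (le_INR 1); destruct (filter (fun j => Nat.eqb j i) (seq 0 n));
      [destruct Hf | simpl; lia]. }
  (* The extra 1 is charged to the summand of [i]; the sums are then compared term by term. *)
  apply Rle_trans with (lsum (fun j =>
     (if in_dec Nat.eq_dec j l then 0 else if is_fixed s' j then free (p j) else 0)
     + (if Nat.eqb j i then 1 else 0)) (seq 0 n)).
  { rewrite lsum_plus; apply Rplus_le_compat; [apply Rle_refl | exact Hone]. }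
  apply lsum_le; intros j _; destruct (in_dec Nat.eq_dec j []) as [[]|_].
  pose proof (free_range (p j)).
  destruct (Nat.eqb_spec j i) as [->|Hj].
  - destruct (in_dec Nat.eq_dec i l) as [_|N]; [|contradiction].
    unfold is_fixed; rewrite Hi', Hfree; lra.
  - destruct (in_dec Nat.eq_dec j l), (is_fixed s' j); lra.
Qed.

(** Termwise: a conflicting [s'] loses an unqueried coordinate, which pays for its mass; otherwise
    its mass is at most its mass given [s], by [submu_cond]. *)
Lemma potential_drop (n : nat) (w : list (option bool) -> R) (p : nat -> R)
  (s : list (option bool)) :
  (forall s', 0 <= w s') -> is_bitwise n p -> length s = n -> submu p s <> 0 ->
  potential n w (filter (is_fixed s) (seq 0 n)) p + expect n p (cover n w)
  <= potential n w [] p + expect n (cond p s) (cover n w).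
Proof.
  intros Hw Hp Hs Hpos; rewrite !expect_cover_one; unfold potential.
  rewrite <- !lsum_plus; apply lsum_le; intros s' Hs'; apply supports_length in Hs'.
  specialize (Hw s').
  pose proof (submu_nonneg n p s' Hp Hs') as M.
  pose proof (submu_nonneg n _ s' (cond_bitwise n p s Hp) Hs') as M'.
  rewrite !Rmult_assoc, <- !Rmult_plus_distr_l; apply Rmult_le_compat_l; [exact Hw|].
  destruct (Req_dec (submu p s') 0) as [E|E]; [rewrite E; lra|].
  destruct (classic (conflict s s')) as [C|C].
  - pose proof (unqueried_conflict n p s s' Hs Hpos E C).
    apply (Rmult_le_compat_l (submu p s')) in H; lra.
  - pose proof (submu_cond n p s s' Hp Hs Hs' C).
    assert (unqueried n (filter (is_fixed s) (seq 0 n)) p s'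
            <= unqueried n [] p s').
    { apply lsum_le; intros j _; destruct (in_dec Nat.eq_dec j []) as [[]|_].
      pose proof (free_range (p j)).
      destruct (in_dec Nat.eq_dec j _), (is_fixed s' j); lra. }
    apply (Rmult_le_compat_l (submu p s')) in H0; lra.
Qed.

(** * Short fractional partitions *)

(** After truncation the weights may no longer add up to 1. The bound 55/64 is the required 7/8
    minus a loss of 1/64, and 1/8 is what is left for the wrong label. *)
Definition short_partition (n k : nat) (g : list bool -> bool)
  (w : bool -> list (option bool) -> R) : Prop :=
  (forall z s, 0 <= w z s) /\
  (forall z s, (k < codim s)%nat -> w z s = 0) /\
  (forall x, In x (cube n) -> 55 / 64 <= cover n (w (g x)) x <= 1) /\
  (forall x, In x (cube n) -> cover n (w (negb (g x))) x <= 1 / 8).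

Lemma short_partition_of_feasible (n k : nat) (g : list bool -> bool)
  (w : bool -> list (option bool) -> R) :
  qprt_feasible n (1 / 8) g w -> 64 * qprt_obj n w <= 2 ^ k ->
  short_partition n k g (fun z s => if Nat.leb (codim s) k then w z s else 0).
Proof.
  intros [Hw [Hg Ht]] Hk.
  set (w' := fun z s => if Nat.leb (codim s) k then w z s else 0).
  assert (Hle : forall z s, 0 <= w' z s <= w z s).
  { intros z s; unfold w'; specialize (Hw z s).
    destruct (Nat.leb (codim s) k); lra. }
  assert (Hmono : forall z x, cover n (w' z) x <= cover n (w z) x).
  { intros z x; apply lsum_le; intros s _; destruct (in_sub x s); [apply Hle | lra]. }
  assert (Hnn : forall z x, 0 <= cover n (w z) x).
  { intros z x; apply lsum_nonneg; intros s _; destruct (in_sub x s); [apply Hw | lra]. }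
  assert (Hsum : forall x, In x (cube n) ->
            cover n (w (g x)) x + cover n (w (negb (g x))) x = 1).
  { intros x Hx; rewrite <- (Ht x Hx); unfold cover; rewrite <- lsum_plus.
    apply lsum_ext; intros s _; destruct (in_sub x s), (g x); simpl; ring. }
  (* Markov's inequality: a dropped subcube costs at least [2 ^ k] per unit of weight, while the
     objective is at most [2 ^ k / 64]. *)
  assert (Hcut : forall z x, cover n (w z) x - cover n (w' z) x <= 1 / 64).
  { intros z x.
    pose proof (pow_lt 2 k ltac:(lra)) as P.
    apply Rmult_le_reg_l with (2 ^ k); [exact P|].
    apply Rle_trans with (qprt_obj n w); [|lra].
    unfold Rminus.
    replace (- cover n (w' z) x) with ((-1) * cover n (w' z) x) by ring.
    unfold cover; rewrite <- lsum_scal, <- lsum_plus, <- lsum_scal.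
    apply lsum_le; intros s _.
    pose proof (Hw false s); pose proof (Hw true s); pose proof (Hw z s).
    pose proof (pow_lt 2 (codim s) ltac:(lra)).
    assert (0 <= (w false s + w true s) * 2 ^ codim s)
      by (apply Rmult_le_pos; lra).
    destruct (in_sub x s); [|lra].
    unfold w'; destruct (Nat.leb_spec (codim s) k) as [Hs|Hs]; [lra|].
    rewrite Rmult_0_r, Rplus_0_r, Rmult_comm.
    apply Rmult_le_compat; [assumption | lra | destruct z; lra |].
    apply Rle_pow; [lra | lia]. }
  split; [|split; [|split]].
  - intros z s; apply Hle.
  - intros z s Hs; unfold w'; destruct (Nat.leb_spec (codim s) k); [lia | reflexivity].
  - intros x Hx; specialize (Hg x Hx); specialize (Hsum x Hx).
    specialize (Hcut (g x) x); specialize (Hmono (g x) x).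
    specialize (Hnn (negb (g x)) x); unfold cover in *; lra.
  - intros x Hx; specialize (Hg x Hx); specialize (Hsum x Hx).
    specialize (Hmono (negb (g x)) x); unfold cover in *; lra.
Qed.

Lemma expect_cover_lower (n k : nat) (g : list bool -> bool)
  (w : bool -> list (option bool) -> R) (p : nat -> R) (z : bool) :
  short_partition n k g w -> is_bitwise n p ->
  55 / 64 * expect n p (indic g z) <= expect n p (cover n (w z)).
Proof.
  intros [Hw [_ [Hg _]]] Hp; rewrite <- expect_scal; apply expect_le; [exact Hp|].
  intros x Hx; unfold indic; destruct (Bool.eqb_spec (g x) z) as [<-|_].
  - specialize (Hg x Hx); lra.
  - rewrite Rmult_0_r; apply lsum_nonneg; intros s _; destruct (in_sub x s); [apply Hw | lra].
Qed.

Lemma expect_cover_upper (n k : nat) (g : list bool -> bool)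
  (w : bool -> list (option bool) -> R) (p : nat -> R) (z : bool) :
  short_partition n k g w -> is_bitwise n p ->
  expect n p (cover n (w z)) <= 1 / 8 + 7 / 8 * expect n p (indic g z).
Proof.
  intros [_ [_ [Hg Hb]]] Hp.
  apply Rle_trans with (expect n p (fun x => 1 / 8 * 1 + 7 / 8 * indic g z x)).
  2: { rewrite expect_plus, !expect_scal, expect_one; lra. }
  apply expect_le; [exact Hp|]; intros x Hx; unfold indic.
  specialize (Hg x Hx); specialize (Hb x Hx).
  destruct (Bool.eqb_spec (g x) z) as [<-|N]; [lra|].
  replace (negb (g x)) with z in Hb by (destruct z, (g x); simpl; congruence).
  lra.
Qed.

(** * Decision trees from short partitions *)

Lemma biased_subcube (n k : nat) (g : list bool -> bool)
  (w : bool -> list (option bool) -> R) (p : nat -> R) :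
  short_partition n k g w -> is_bitwise n p ->
  48 / 100 < expect n p (indic g false) ->
  exists s, length s = n /\ (codim s <= k)%nat /\ submu p s <> 0 /\
    expect n (cond p s) (indic g true) <= 1 / 5.
Proof.
  intros HP Hp Hbal; apply NNPP; intros N.
  pose proof (expect_cover_lower n k g w p false HP Hp) as L.
  pose proof (expect_indic n p g) as T.
  assert (U : expect n p (fun x => indic g true x * cover n (w false) x)
              <= 1 / 8 * expect n p (indic g true)).
  { destruct HP as [_ [_ [_ Hb]]].
    rewrite <- expect_scal; apply expect_le; [exact Hp|]; intros x Hx.
    specialize (Hb x Hx); unfold indic; destruct (g x); simpl in *; lra. }
  destruct HP as [Hw [Hk _]].
  (* Under the negated claim, ones fill more than 1/5 of every short non-null subcube; this is
     averaged over the 0-labelled ones. *)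
  assert (V : 1 / 5 * expect n p (cover n (w false))
              <= expect n p (fun x => indic g true x * cover n (w false) x)).
  { rewrite expect_cover, expect_cover_one, <- lsum_scal; apply lsum_le.
    intros s Hs; apply supports_length in Hs.
    pose proof (submu_nonneg n p s Hp Hs) as M.
    destruct (le_lt_dec (codim s) k) as [Hc|Hc]; [|rewrite (Hk false s Hc); lra].
    destruct (Req_dec (submu p s) 0) as [E|E]; [rewrite E; lra|].
    destruct (Rle_lt_dec (expect n (cond p s) (indic g true)) (1 / 5)) as [H|H].
    - exfalso; apply N; exists s; auto.
    - rewrite Rmult_comm; apply Rmult_le_compat_l; [|lra].
      apply Rmult_le_pos; [apply Hw | exact M]. }
  (* Ones have mass below 0.52, so [U] gives at most 0.065, while [V] and [L] give more than 1/5 *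
     55/64 * 0.48 = 0.0825. *)
  lra.
Qed.

(** With [e] the excess of the error over [0.48], induction gives
    [c * T * e <= potential - c] after the first round, and [e <= 1] pays for
    the missing [c * e]. *)
Lemma tree_of_short_partition (n k : nat) (g : list bool -> bool)
  (w : bool -> list (option bool) -> R) (T : nat) :
  short_partition n k g w ->
  forall p, is_bitwise n p -> exists t,
    (depth t <= T * k)%nat /\
    1 / 10 * INR T * (err n p g t - 48 / 100) <= potential n (w true) [] p.
Proof.
  intros HP; assert (Hw : forall s, 0 <= w true s) by apply HP.
  induction T as [|T IH]; intros p Hp;
    pose proof (potential_nonneg n (w true) [] p Hw Hp) as Hpot.
  - exists (Leaf true); simpl; split; [lia|lra].
  - pose proof (pos_INR (S T)) as HT.
    destruct (Rle_lt_dec (expect n p (indic g true)) (48 / 100)) as [H1|H1].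
    { exists (Leaf false); split; [simpl; lia|]; rewrite err_leaf; simpl negb; nra. }
    destruct (Rle_lt_dec (expect n p (indic g false)) (48 / 100)) as [H0|H0].
    { exists (Leaf true); split; [simpl; lia|]; rewrite err_leaf; simpl negb; nra. }
    destruct (biased_subcube n k g w p HP Hp H0) as [s [Hs [Hk [Hpos Hs1]]]].
    (* The induction hypothesis enters in affine form, with the 0.48 moved into [b], to be carried
       through the queries of the bits fixed by [s]. *)
    destruct (query_list n g (w true) (1 / 10 * INR T)
                (1 / 10 * INR T * (48 / 100)) (T * k)
                (filter (is_fixed s) (seq 0 n))) with (p := p) as [t [Ht Et]].
    + intros i Hi; apply filter_In in Hi; destruct Hi as [Hi _].
      apply in_seq in Hi; lia.
    + intros p' Hp'; destruct (IH p' Hp') as [t [D E]].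
      exists t; split; [exact D | lra].
    + exact Hp.
    + exists t; split.
      * rewrite <- Hs, fixed_codim in Ht; simpl; lia.
      * pose proof (err_le_1 n p g t Hp) as He.
        pose proof (potential_drop n (w true) p s Hw Hp Hs Hpos) as Hd.
        pose proof (expect_cover_lower n k g w p true HP Hp) as HL.
        pose proof (expect_cover_upper n k g w _ true HP (cond_bitwise n p s Hp)) as HU.
        (* [HL] gives more than 55/64 * 0.48 = 0.4125 and [HU] at most 1/8 + 7/8 * 1/5 = 0.3, so the
           potential drops by over 0.11; the extra round costs at most 0.052. *)
        rewrite S_INR; lra.
Qed.

(** Each surviving subcube has at most [k] fixed bits, and the expected 1-labelled weight is at most
    1. *)
Lemma potential_le (n k : nat) (g : list bool -> bool)
  (w : bool -> list (option bool) -> R) (p : nat -> R) :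
  short_partition n k g w -> is_bitwise n p ->
  potential n (w true) [] p <= INR k.
Proof.
  intros HP Hp; apply Rle_trans with (INR k * expect n p (cover n (w true))).
  - destruct HP as [Hw [Hk _]].
    rewrite expect_cover_one, <- lsum_scal; apply lsum_le; intros s Hs.
    apply supports_length in Hs; rewrite Rmult_comm.
    pose proof (submu_nonneg n p s Hp Hs) as M.
    destruct (le_lt_dec (codim s) k) as [Hc|Hc]; [|rewrite (Hk true s Hc); lra].
    apply Rmult_le_compat_r; [apply Rmult_le_pos; auto|].
    apply Rle_trans with (INR (codim s)); [now apply unqueried_le_codim|].
    now apply le_INR.
  - pose proof (expect_cover_upper n k g w p true HP Hp).
    pose proof (expect_indic n p g).
    assert (0 <= expect n p (indic g false)).
    { apply lsum_nonneg; intros x Hx; apply cube_length in Hx.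
      pose proof (mu_nonneg n p x Hp Hx); unfold indic.
      destruct (Bool.eqb (g x) false); lra. }
    pose proof (pos_INR k); nra.
Qed.

Lemma QC_quadratic (n k : nat) (g : list bool -> bool)
  (w : bool -> list (option bool) -> R) (p : nat -> R) (q : nat) :
  (0 < k)%nat -> short_partition n k g w -> is_bitwise n p ->
  is_QC n p (49 / 100) g q -> (q <= 1000 * k * k)%nat.
Proof.
  intros Hk HP Hp [_ Hq].
  (* With [1000 * k] rounds, 100 k (err - 0.48) is at most [k], so the error is at most 0.49. *)
  destruct (tree_of_short_partition n k g w (1000 * k) HP p Hp) as [t [D E]].
  transitivity (depth t); [apply Hq | exact D].
  pose proof (potential_le n k g w p HP Hp) as HU.
  rewrite mult_INR in E; apply lt_0_INR in Hk.
  replace (INR 1000) with 1000 in E by (rewrite INR_IZR_INZ; reflexivity).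
  nra.
Qed.

(** * The truncation level in terms of logarithms *)

Lemma codim_bound_exists (v : R) :
  exists k : nat, (0 < k)%nat /\ 64 * v <= 2 ^ k /\
    1000 * INR k * INR k <= 121000 * (log2 v * log2 (log2 v)) ^ 2 + 121000.
Proof.
  assert (L2 : 0 < ln 2) by (rewrite <- ln_1; apply ln_increasing; lra).
  (* Up to 16 the logarithms may be negative or take default values; there only the square's sign is
     used, and the additive constant absorbs 1000 * 10 * 10. The choice 10 fits since 64 * 16 = 2 ^
     10. *)
  destruct (Rle_lt_dec v 16) as [Hv|Hv].
  - exists 10%nat; split; [lia|split; [lra|]].
    pose proof (pow2_ge_0 (log2 v * log2 (log2 v))).
    replace (INR 10) with 10 by (rewrite INR_IZR_INZ; reflexivity); lra.
  - assert (Hln : forall m : nat, ln (2 ^ m) / ln 2 = INR m)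
      by (intros m; rewrite ln_pow by lra; field; lra).
    assert (Hmono : forall x y, 0 < x <= y -> log2 x <= log2 y).
    { intros x y [Hx Hxy]; destruct Hxy as [Hxy | ->]; [|lra]; unfold log2.
      apply Rmult_le_compat_r; [left; now apply Rinv_0_lt_compat|].
      left; now apply ln_increasing. }
    assert (HL : 4 <= log2 v).
    { replace 4 with (log2 (2 ^ 4)) by (unfold log2; rewrite Hln; simpl; lra).
      apply Hmono; lra. }
    assert (HLL : 2 <= log2 (log2 v)).
    { replace 2 with (log2 (2 ^ 2)) at 1 by (unfold log2; rewrite Hln; simpl; lra).
      apply Hmono; lra. }
    (* The 6 accounts for the factor 64; rounding up gives [k] at most [log2 v + 7]. *)
    destruct (archimed (log2 v + 6)) as [A1 A2].
    set (k := Z.to_nat (up (log2 v + 6))).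
    assert (HZ : (0 < up (log2 v + 6))%Z) by (apply lt_IZR; lra).
    assert (Hk : INR k = IZR (up (log2 v + 6))).
    { unfold k; rewrite INR_IZR_INZ, Z2Nat.id by lia; reflexivity. }
    exists k; split; [unfold k; lia|split].
    + replace 64 with (2 ^ 6) by lra.
      rewrite <- !Rpower_pow by lra.
      replace v with (Rpower 2 (log2 v)) at 1.
      2: { unfold Rpower, log2; replace (ln v / ln 2 * ln 2) with (ln v) by (field; lra).
           apply exp_ln; lra. }
      rewrite <- Rpower_plus; apply Rle_Rpower; [lra|].
      simpl INR at 1; lra.
    (* From [HL] and [HLL], [log2 v + 7] is at most [4 * log2 v], hence at most the stated
       product. *)
    + assert (0 <= INR k <= 2 * (log2 v * log2 (log2 v))) by nra.
      nra.
Qed.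

Theorem theorem2 :
  exists C : R, 0 < C /\
    forall (n : nat) (g : list bool -> bool) (p : nat -> R) (q : nat) (v : R),
      (1 <= n)%nat ->
      is_bitwise n p ->
      is_QC n p (49 / 100) g q ->
      is_qprt n (1 / 8) g v ->
      INR q <= C * (log2 v * log2 (log2 v)) ^ 2 + C.
Proof.
  exists 121000; split; [lra|].
  intros n g p q v _ Hp HQ [[w [Hw Hv]] _].
  destruct (codim_bound_exists v) as [k [Hk [Hkv HC]]].
  rewrite <- Hv in Hkv.
  pose proof (short_partition_of_feasible n k g w Hw Hkv) as HP.
  apply (QC_quadratic _ _ _ _ _ _ Hk HP Hp), le_INR in HQ.
  rewrite !mult_INR in HQ.
  replace (INR 1000) with 1000 in HQ by (rewrite INR_IZR_INZ; reflexivity).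
  lra.
Qed.
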